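(* Consider a (new) conic problem with data $(P,q,A,b)$ and cone $\mathcal{K}$, and let $(x^*,s^*,z^* )$ be the optimal solution of a previous problem with the same structure, so that $s^*\in\mathcal{K}$, $z^*\in\mathcal{K}^*$ and $\langle s^*,z^*\rangle=0$. Given $\lambda>0$ and $\mu^0>0$, define $c:=s^*-\lambda z^*$, $s^0:=\arg\min_{s\in\operatorname{int}\mathcal{K}}\frac12\|s-c\|_2^2+\mu^0 f(s)$ with $f$ the logarithmically-homogeneous self-concordant barrier of $\mathcal{K}$ listed below, $z^0:=(s^0-c)/\lambda$ and $x^0:=x^*$. Then: (i) (Nonnegative cone) If $\mathcal{K}=\mathbb{R}^n_{+}$, for every $i$ at least one of $s^*_i,z^*_i$ is nonzero, $\lambda=1$ and $\mu^0=\|R(x^*,s^*,z^* )\|_\infty$, then the residual $R(x^0,s^0,z^0)$ of the initial point is of magnitude $O(\mu^0)$. (ii) (PSD cone) If $\mathcal{K}$ is the cone of $n\times n$ symmetric positive semidefinite matrices, the matrices $S^*,Z^*$ corresponding to $s^*,z^*$ satisfy $\operatorname{rank}(S^* )+\operatorname{rank}(Z^* )=n$, $\lambda=1$ and $\mu^0=\|R(x^*,s^*,z^* )\|_\infty$, then the residual $R(x^0,s^0,z^0)$ is of magnitude $O(\mu^0)$. (iii) (Second-order cone) If $\mathcal{K}=\mathcal{K}^n_{\mathrm{soc}}$, $s^*=(s^*_0,s^*_1)$, $z^*=(z^*_0,z^*_1)\in\mathbb{R}\times\mathbb{R}^{n-1}$ with $s^*_0,z^*_0>0$, $\lambda=s^*_0/z^*_0$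 and $\mu^0=\lambda\|R(x^*,s^*,z^* )\|_\infty$, then the residual $R(x^0,s^0,z^0)$ is of magnitude $O(\mu^0)$.
   Context: The conic problem is $\min_{x,s}\frac12 x^\top Px+q^\top x$ s.t. $Ax+s=b$, $s\in\mathcal{K}$ with $P$ symmetric positive semidefinite, and its dual has constraint $Px+A^\top z+q=0$, $z\in\mathcal{K}^*$. The residual map (evaluated with the new problem's data) is $$R(x,s,z):=\begin{bmatrix}P & A^\top\\ -A & 0\end{bmatrix}\begin{bmatrix}x\\ z\end{bmatrix}+\begin{bmatrix}q\\ b\end{bmatrix}-\begin{bmatrix}0\\ s\end{bmatrix}.$$ Barriers: for $\mathbb{R}^n_+$, $f(s)=-\sum_i\log s_i$; for the PSD cone (matrices identified with vectors via $S=\mathrm{mat}(s)$), $f(s)=-\log\det\mathrm{mat}(s)$; for $\mathcal{K}^n_{\mathrm{soc}}=\{(t,x)\in\mathbb{R}\times\mathbb{R}^{n-1}:\|x\|_2\le t\}$, $f(s)=-\frac12\log(s_0^2-\|s_1\|^2)$. ''Of magnitude $O(\mu^0)$'' means bounded by $\mu^0$ times a factor depending on the problem data and on $(s^*,z^* )$. *)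

(* Defs.v *)
From HB Require Import structures.
From mathcomp Require Import all_boot all_order all_algebra.
From mathcomp Require Import all_classical all_reals all_analysis.
Set Implicit Arguments. Unset Strict Implicit. Unset Printing Implicit Defensive.
Import Order.TTheory GRing.Theory Num.Theory.
Local Open Scope ring_scope.

Definition dotv {R : realType} {n : nat} (u v : 'cV[R]_n) : R :=
  \sum_(i < n) u i 0 * v i 0.
Definition norm2sq {R : realType} {n : nat} (u : 'cV[R]_n) : R := dotv u u.
Definition norm_inf {R : realType} {n : nat} (v : 'cV[R]_n) : R :=
  \big[Num.max/0]_(i < n) `|v i 0|.

Definition dual_cone {R : realType} {n : nat} (K : 'cV[R]_n -> Prop)
  (z : 'cV[R]_n) : Prop := forall s, K s -> 0 <= dotv s z.

Definition psd_mat {R : realType} {n : nat} (S : 'M[R]_n) : Prop :=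
  S^T = S /\ forall v : 'cV[R]_n, 0 <= (v^T *m S *m v) 0 0.
Definition pd_mat {R : realType} {n : nat} (S : 'M[R]_n) : Prop :=
  S^T = S /\ forall v : 'cV[R]_n, v != 0 -> 0 < (v^T *m S *m v) 0 0.

Definition residual {R : realType} {nx k : nat} (P : 'M[R]_nx) (q : 'cV[R]_nx)
  (A : 'M[R]_(k, nx)) (b : 'cV[R]_k) (x : 'cV[R]_nx) (s z : 'cV[R]_k)
  : 'cV[R]_(nx + k) :=
  col_mx (P *m x + A^T *m z + q) (- (A *m x) + b - s).

Definition is_argmin {R : realType} {k : nat} (D : 'cV[R]_k -> Prop)
  (g : 'cV[R]_k -> R) (s0 : 'cV[R]_k) : Prop :=
  D s0 /\ forall s, D s -> g s0 <= g s.

Definition bar_obj {R : realType} {k : nat} (f : 'cV[R]_k -> R) (mu : R)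
  (c : 'cV[R]_k) (s : 'cV[R]_k) : R :=
  2^-1 * norm2sq (s - c) + mu * f s.

Definition nonneg_cone {R : realType} {n : nat} (s : 'cV[R]_n) : Prop :=
  forall i, 0 <= s i 0.
Definition nonneg_int {R : realType} {n : nat} (s : 'cV[R]_n) : Prop :=
  forall i, 0 < s i 0.
Definition nonneg_barrier {R : realType} {n : nat} (s : 'cV[R]_n) : R :=
  - \sum_(i < n) ln (s i 0).

Definition mat {R : realType} {n : nat} (s : 'cV[R]_(n * n)) : 'M[R]_n :=
  vec_mx (s^T).
Definition psd_cone {R : realType} {n : nat} (s : 'cV[R]_(n * n)) : Prop :=
  psd_mat (mat s).
(* interior relative to the space of symmetric matrices *)
Definition psd_int {R : realType} {n : nat} (s : 'cV[R]_(n * n)) : Prop :=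
  pd_mat (mat s).
(* dual cone taken inside the space of symmetric matrices *)
Definition psd_dual {R : realType} {n : nat} (z : 'cV[R]_(n * n)) : Prop :=
  (mat z)^T = mat z /\ dual_cone (@psd_cone R n) z.
Definition psd_barrier {R : realType} {n : nat} (s : 'cV[R]_(n * n)) : R :=
  - ln (\det (mat s)).

Definition soc_t {R : realType} {n : nat} (s : 'cV[R]_n.+1) : R := s ord0 0.
Definition soc_x {R : realType} {n : nat} (s : 'cV[R]_n.+1) : 'cV[R]_n :=
  \col_(i < n) s (lift ord0 i) 0.
Definition soc_cone {R : realType} {n : nat} (s : 'cV[R]_n.+1) : Prop :=
  Num.sqrt (norm2sq (soc_x s)) <= soc_t s.
Definition soc_int {R : realType} {n : nat} (s : 'cV[R]_n.+1) : Prop :=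
  Num.sqrt (norm2sq (soc_x s)) < soc_t s.
Definition soc_barrier {R : realType} {n : nat} (s : 'cV[R]_n.+1) : R :=
  - (2^-1 * ln (soc_t s ^+ 2 - norm2sq (soc_x s))).

(* Main.v *)
Require Import Defs.
From HB Require Import structures.
From mathcomp Require Import all_boot all_order all_algebra.
From mathcomp Require Import all_classical all_reals all_analysis.
From mathcomp Require Import ring lra.
Set Implicit Arguments. Unset Strict Implicit. Unset Printing Implicit Defensive.
Import Order.TTheory GRing.Theory Num.Theory.
Local Open Scope ring_scope.

(** Since z0 - z* = (s0 - s* ) / lambda, it suffices that s0 - s* = O(mu).  In
    each cone there is an explicit interior point p = s* + mu w at which the
    gradient of the barrier objective equals mu h, with w and h depending only
    on (s*, z* ): w is the inverse of z* for the orthant, the pseudo-inverse of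
    Z* for the PSD cone, and (1, -s1*/s0* ) / (4 s0* ) for the second-order cone.
    The objective is 1-strongly convex, so |s0 - p| <= 2 mu |h|. *)

(** * Euclidean inner product and the distance from a test point to the minimizer *)

Section Vectors.
Context {R : realType} {k : nat}.
Implicit Types (u v w : 'cV[R]_k) (a : R).

Lemma dotvE u v : dotv u v = (u^T *m v) 0 0.
Proof. by rewrite mxE; apply: eq_bigr => i _; rewrite mxE. Qed.

Lemma dotvC u v : dotv u v = dotv v u.
Proof. by apply: eq_bigr => i _; rewrite mulrC. Qed.

Lemma dotvDl u v w : dotv (u + v) w = dotv u w + dotv v w.
Proof. by rewrite !dotvE linearD mulmxDl mxE. Qed.

Lemma dotvDr u v w : dotv u (v + w) = dotv u v + dotv u w.
Proof. by rewrite !dotvE mulmxDr mxE. Qed.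

Lemma dotvZl a u v : dotv (a *: u) v = a * dotv u v.
Proof. by rewrite !dotvE linearZ -scalemxAl mxE. Qed.

Lemma dotvZr a u v : dotv u (a *: v) = a * dotv u v.
Proof. by rewrite dotvC dotvZl dotvC. Qed.

Lemma norm2sq_ge0 u : 0 <= norm2sq u.
Proof. by apply: sumr_ge0 => i _; rewrite -expr2 sqr_ge0. Qed.

Lemma norm2sq_eq0 u : (norm2sq u == 0) = (u == 0).
Proof.
apply/eqP/eqP => [u0|->]; last by rewrite /norm2sq dotvE mulmx0 mxE.
apply/matrixP => i j; rewrite ord1 mxE; apply/eqP.
rewrite -sqrf_eq0 expr2; apply/eqP.
by apply: (psumr_eq0P _ u0) => // l _; rewrite -expr2 sqr_ge0.
Qed.

Lemma sqr_coord_le u i : u i 0 ^+ 2 <= norm2sq u.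
Proof.
rewrite /norm2sq /dotv (bigD1 i) //= expr2 lerDl.
by apply: sumr_ge0 => j _; rewrite -expr2 sqr_ge0.
Qed.

Lemma norm_coord_le u i : `|u i 0| <= Num.sqrt (norm2sq u).
Proof. by rewrite -sqrtr_sqr ler_wsqrtr ?sqr_coord_le. Qed.

Lemma norm2sqD u v : norm2sq (u + v) = norm2sq u + 2 * dotv u v + norm2sq v.
Proof. by rewrite /norm2sq dotvDl !dotvDr (dotvC v u); ring. Qed.

Lemma norm2sqZ a u : norm2sq (a *: u) = a ^+ 2 * norm2sq u.
Proof. by rewrite /norm2sq dotvZl dotvZr; ring. Qed.

Lemma Cauchy_Schwarz_dotv u v : dotv u v ^+ 2 <= norm2sq u * norm2sq v.
Proof.
have [->|v0] := eqVneq v 0.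
  by rewrite /norm2sq !dotvE !mulmx0 mxE mulr0 expr0n.
have nv : 0 < norm2sq v by rewrite lt_def norm2sq_ge0 norm2sq_eq0 v0.
(* This vector is [norm2sq v] times the component of [u] orthogonal to [v]; its squared norm is
   [b * (a * b - d ^+ 2)]. *)
have := norm2sq_ge0 (norm2sq v *: u + (- dotv u v) *: v).
rewrite norm2sqD !norm2sqZ dotvZl dotvZr.
set d := dotv u v; set a := norm2sq u; set b := norm2sq v => h.
have : 0 <= b * (a * b - d ^+ 2) by nra.
by rewrite pmulr_rge0 // subr_ge0.
Qed.

Lemma norm_dotv_le u v :
  `|dotv u v| <= Num.sqrt (norm2sq u) * Num.sqrt (norm2sq v).
Proof.
rewrite -sqrtrM ?norm2sq_ge0// -sqrtr_sqr ler_wsqrtr//.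
exact: Cauchy_Schwarz_dotv.
Qed.

Lemma norm_inf_ge0 v : 0 <= norm_inf v.
Proof. exact: bigmax_ge_id. Qed.

Lemma norm_inf_coord v i : `|v i 0| <= norm_inf v.
Proof. exact: le_bigmax. Qed.

Lemma norm_inf_le v a : 0 <= a -> (forall i, `|v i 0| <= a) -> norm_inf v <= a.
Proof. by move=> a0 h; apply: bigmax_le. Qed.

(* Convexity makes the objective g 1-strongly convex, so that
   0 >= g s0 - g p >= <grad g (p), s0 - p> + |s0 - p|^2 / 2. *)
Lemma argmin_dist_le (D : 'cV[R]_k -> Prop) (f : 'cV[R]_k -> R) mu c s0 p G :
  0 <= mu -> is_argmin D (bar_obj f mu c) s0 -> D p ->
  (forall s, D s -> f p + dotv G (s - p) <= f s) ->
  norm2sq (s0 - p) <= 4 * norm2sq (p - c + mu *: G).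
Proof.
move=> mu0 [Ds0 min0] Dp subgrad.
have := min0 _ Dp; have := subgrad _ Ds0; rewrite /bar_obj.
have -> : s0 - c = (s0 - p) + (p - c) by rewrite addrA subrK.
move: (s0 - p) (p - c) => e d; rewrite (norm2sqD e d) => le1 le2.
(* With r = d + mu G, minimality and the subgradient give |e|^2 + 2<e, r> <= 0. Subtracting twice
   this from |e + 2r|^2 >= 0 leaves |e|^2 <= 4|r|^2. *)
have /= := norm2sq_ge0 (e + 2 *: (d + mu *: G)).
rewrite norm2sqD norm2sqZ dotvZr dotvDr dotvZr (dotvC e G).
have : mu * (f p + dotv G e) <= mu * f s0 by rewrite ler_wpM2l.
by lra.
Qed.

(** The form shared by the three cones: s0 - ss is split at the test point p = ss + mu w. The
    distance from s0 to p contributes 2 mu |h|, and p - ss contributes mu |w|. Each cone only has to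
    supply [w], [h] and a subgradient [G] at p. *)
Lemma argmin_coord_dist (D : 'cV[R]_k -> Prop) (f : 'cV[R]_k -> R)
    mu c s0 ss w h G i :
  0 < mu -> is_argmin D (bar_obj f mu c) s0 -> D (ss + mu *: w) ->
  (forall s, D s -> f (ss + mu *: w) + dotv G (s - (ss + mu *: w)) <= f s) ->
  ss + mu *: w - c + mu *: G = mu *: h ->
  `|(s0 - ss) i 0| <= (2 * Num.sqrt (norm2sq h) + norm_inf w) * mu.
Proof.
move=> mu0 min0 Dp subgrad gradE.
have := argmin_dist_le (ltW mu0) min0 Dp subgrad; rewrite gradE norm2sqZ => dle.
have -> : s0 - ss = (s0 - (ss + mu *: w)) + mu *: w.
  by rewrite opprD addrA subrK.
rewrite mxE (le_trans (ler_normD _ _))// mulrDl lerD//; last first.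
  by rewrite mxE normrM mulrC (gtr0_norm mu0) ler_wpM2r ?(ltW mu0)// norm_inf_coord.
apply: (le_trans (norm_coord_le _ _)).
rewrite (_ : 2 * _ * mu = Num.sqrt (4 * (mu ^+ 2 * norm2sq h))) ?ler_wsqrtr//.
rewrite mulrA sqrtrM; last by rewrite mulr_ge0 ?sqr_ge0.
rewrite (_ : 4 * mu ^+ 2 = (2 * mu) ^+ 2); last by ring.
by rewrite sqrtr_sqr gtr0_norm ?mulr_gt0//; ring.
Qed.

End Vectors.

(** * Effect on the residual of moving the slack and the dual variable *)

Section ResidualPerturbation.
Context {R : realType} {nx k : nat}.
Context (P : 'M[R]_nx) (q : 'cV[R]_nx) (A : 'M[R]_(k, nx)) (b : 'cV[R]_k).

Definition abs_sum : R := \sum_i \sum_j `|A i j|.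

Lemma abs_sum_ge0 : 0 <= abs_sum.
Proof. by apply: sumr_ge0 => i _; apply: sumr_ge0. Qed.

Lemma norm_trmulmx_le (d : 'cV[R]_k) a j : (forall i, `|d i 0| <= a) ->
  `|(A^T *m d) j 0| <= abs_sum * a.
Proof.
move=> da; rewrite mxE (le_trans (ler_norm_sum _ _ _))// mulr_suml ler_sum// => i _.
rewrite normrM mxE ler_pM// (bigD1 j)//= lerDl.
exact: sumr_ge0.
Qed.

(** The residual is affine, and z0 - zs = (s0 - ss) / lam, so it changes by A^T (s0 - ss) / lam in
    the upper block and by -(s0 - ss) in the lower one. The term [lam^-1] of the constant pays for
    the old residual, which has norm mu / lam. *)
Lemma residual_perturb_le (x : 'cV[R]_nx) (ss zs s0 : 'cV[R]_k) lam K :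
  let rho := norm_inf (residual P q A b x ss zs) in
  let mu := lam * rho in
  0 < lam -> 0 <= K -> (forall i, `|(s0 - ss) i 0| <= K * mu) ->
  norm_inf (residual P q A b x s0 (lam^-1 *: (s0 - (ss - lam *: zs))))
    <= (lam^-1 + (lam^-1 * abs_sum + 1) * K) * mu.
Proof.
move=> rho mu lam0 K0 dist.
have rho0 : 0 <= rho by exact: norm_inf_ge0.
have mu0 : 0 <= mu by rewrite mulr_ge0 // ltW.
have li0 : 0 <= lam^-1 by rewrite invr_ge0 ltW.
have Kmu0 : 0 <= K * mu by rewrite mulr_ge0.
have -> : lam^-1 *: (s0 - (ss - lam *: zs)) = zs + lam^-1 *: (s0 - ss).
  by rewrite opprB addrC -addrA (addrC _ s0) scalerDr scalerA mulVf ?gt_eqF// scale1r.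
have -> : residual P q A b x s0 (zs + lam^-1 *: (s0 - ss)) =
    residual P q A b x ss zs + col_mx (lam^-1 *: (A^T *m (s0 - ss))) (- (s0 - ss)).
  rewrite /residual add_col_mx; congr col_mx.
    by rewrite mulmxDr -scalemxAr addrA -!addrA; congr (_ + (_ + _)); rewrite addrC.
  by rewrite opprB addrA subrK.
have rhoE : lam^-1 * mu = rho by rewrite mulrA mulVf ?mul1r// gt_eqF.
have -> : (lam^-1 + (lam^-1 * abs_sum + 1) * K) * mu
   = rho + (lam^-1 * (abs_sum * (K * mu)) + K * mu) by rewrite -rhoE; ring.
have AK : 0 <= lam^-1 * (abs_sum * (K * mu)).
  by rewrite mulr_ge0 // mulr_ge0 // abs_sum_ge0.
apply: norm_inf_le => [|i]; first by rewrite !addr_ge0.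
rewrite mxE (le_trans (ler_normD _ _))// lerD ?norm_inf_coord//.
case: (splitP i) => j ij.
  have -> : i = lshift k j by apply: val_inj.
  rewrite col_mxEu mxE normrM (ger0_norm li0) ler_wpDr//.
  by rewrite ler_wpM2l// norm_trmulmx_le.
have -> : i = rshift nx j by apply: val_inj.
by rewrite col_mxEd mxE normrN ler_wpDl.
Qed.

End ResidualPerturbation.

(** * Tangent-line bounds for the logarithm *)

Section Logarithm.
Context {R : realType}.
Implicit Types x y : R.

Lemma ln_le_sub1 x : 0 < x -> ln x <= x - 1.
Proof.
move=> x0; rewrite -{1}(subrK 1 x) addrC le_ln1Dx//.
by rewrite ltrBrDr addNr.
Qed.

Lemma ln_le_tangent x y : 0 < x -> 0 < y -> ln x <= ln y + y^-1 * (x - y).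
Proof.
move=> x0 y0; rewrite -lerBlDl -ln_div ?posrE//.
by rewrite (le_trans (ln_le_sub1 _)) ?divr_gt0// mulrBr mulVf ?gt_eqF// mulrC.
Qed.

Lemma ln_prod_le (I : finType) (x : I -> R) : (forall i, 0 < x i) ->
  ln (\prod_i x i) <= \sum_i (x i - 1).
Proof.
move=> x0; suff [] : 0 < \prod_i x i /\ ln (\prod_i x i) <= \sum_i (x i - 1) by [].
(* Positivity of the partial product is carried along because [lnM] requires it. *)
apply: (big_rec2 (fun s p => 0 < s /\ ln s <= p)); first by rewrite ln1.
move=> i p s _ [p0 ple]; rewrite mulr_gt0 // lnM ?posrE //.
by split => //; rewrite lerD// ln_le_sub1.
Qed.

End Logarithm.

(** * The nonnegative orthant *)

Section Orthant.
Context {R : realType} {k : nat}.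
Implicit Types (s z p : 'cV[R]_k).

Lemma nonneg_barrier_subgradient p s : nonneg_int p -> nonneg_int s ->
  nonneg_barrier p + dotv (\col_i (- (p i 0)^-1)) (s - p) <= nonneg_barrier s.
Proof.
move=> p0 s0; rewrite /nonneg_barrier /dotv -!sumrN -big_split ler_sum// => i _.
by rewrite !mxE /=; have := ln_le_tangent (s0 i) (p0 i); lra.
Qed.

(** Tested on the standard basis vectors. *)
Lemma nonneg_dual_ge0 z : dual_cone nonneg_cone z -> nonneg_cone z.
Proof.
move=> zK i; have := zK (delta_mx i 0).
rewrite /dotv (bigD1 i)//= mxE !eqxx mul1r big1 ?addr0; last first.
  by move=> j /negPf ji; rewrite mxE ji mul0r.
by apply => j; rewrite mxE ler0n.
Qed.

Lemma nonneg_complementary s z i : nonneg_cone s -> nonneg_cone z ->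
  dotv s z = 0 -> s i 0 * z i 0 = 0.
Proof. by move=> s0 z0 sz; apply: (psumr_eq0P _ sz) => // j _; rewrite mulr_ge0. Qed.

Lemma nonneg_argmin_dist ss zs : nonneg_cone ss -> dual_cone nonneg_cone zs ->
  dotv ss zs = 0 -> (forall i, ss i 0 != 0 \/ zs i 0 != 0) ->
  exists2 K : R, 0 <= K & forall mu s0, 0 < mu ->
    is_argmin nonneg_int (bar_obj nonneg_barrier mu (ss - 1 *: zs)) s0 ->
    forall i, `|(s0 - ss) i 0| <= K * mu.
Proof.
move=> sK /nonneg_dual_ge0 zK sz str.
(* In a field of MathComp 0^-1 = 0, so w and h select the active
   coordinates by themselves. *)
pose w : 'cV[R]_k := \col_i (zs i 0)^-1.
pose h : 'cV[R]_k := \col_i ((zs i 0)^-1 - (ss i 0)^-1).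
exists (2 * Num.sqrt (norm2sq h) + norm_inf w).
  by rewrite addr_ge0 ?mulr_ge0 ?sqrtr_ge0 ?norm_inf_ge0.
move=> mu s0 mu0 min0 i.
pose p := ss + mu *: w.
have alt j : (ss j 0 = 0 /\ 0 < zs j 0) \/ (zs j 0 = 0 /\ 0 < ss j 0).
  have /eqP := nonneg_complementary j sK zK sz; rewrite mulf_eq0.
  by case/orP=> /eqP e; [left|right]; split=> //; rewrite lt_def ?sK ?zK andbT;
    case: (str j) => //; rewrite e eqxx.
have p0 : nonneg_int p.
  move=> j; rewrite !mxE; case: (alt j) => -[-> h0].
    by rewrite add0r mulr_gt0 ?invr_gt0.
  by rewrite invr0 mulr0 addr0.
apply: (argmin_coord_dist (G := \col_j - (p j 0)^-1) _ mu0 min0 p0).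
  by move=> s s_gt0; exact: nonneg_barrier_subgradient.
apply/matrixP => j l; rewrite ord1 !mxE mul1r.
(* Where ss vanishes, p_j = mu / zs_j, so the barrier term -mu / p_j cancels -c_j = zs_j and mu /
   zs_j remains. Where zs vanishes, p_j = c_j = ss_j and only -mu / ss_j remains. *)
case: (alt j) => -[-> h0]; rewrite !invr0.
  by field; rewrite !gt_eqF.
by field; rewrite !gt_eqF.
Qed.

End Orthant.

(** * Semidefinite matrices: Cholesky factors and concavity of log det *)

Section PositiveSemidefinite.
Context {R : realType}.

(** This and [scalemxE] are restricted forms of [mxE] that leave matrix products folded. *)
Lemma addmxE m n (A B : 'M[R]_(m, n)) i j : (A + B) i j = A i j + B i j.
Proof. by rewrite mxE. Qed.

Lemma scalemxE m n (a : R) (A : 'M[R]_(m, n)) i j : (a *: A) i j = a * A i j.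
Proof. by rewrite mxE. Qed.

Lemma gram_diag m n (X : 'M[R]_(m, n)) j : (X^T *m X) j j = norm2sq (col j X).
Proof. by rewrite mxE; apply: eq_bigr => l _; rewrite !mxE. Qed.

Lemma gram_form m n (L : 'M[R]_(n, m)) (v : 'cV[R]_n) :
  (v^T *m (L *m L^T) *m v) 0 0 = norm2sq (L^T *m v).
Proof. by rewrite /norm2sq dotvE trmx_mul trmxK !mulmxA. Qed.

Lemma gram_psd m n (L : 'M[R]_(n, m)) : psd_mat (L *m L^T).
Proof.
split=> [|v]; first by rewrite trmx_mul trmxK.
by rewrite gram_form norm2sq_ge0.
Qed.

Lemma psd_congr m n (B : 'M[R]_(m, n)) (S : 'M[R]_n) :
  psd_mat S -> psd_mat (B *m S *m B^T).
Proof.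
move=> [symS psdS]; split=> [|v]; first by rewrite !trmx_mul trmxK symS mulmxA.
by have := psdS (B^T *m v); rewrite trmx_mul trmxK !mulmxA.
Qed.

Lemma psd_addZ n (S T : 'M[R]_n) (a : R) :
  0 <= a -> psd_mat S -> psd_mat T -> psd_mat (S + a *: T).
Proof.
move=> a0 [symS psdS] [symT psdT]; split=> [|v].
  by rewrite linearD linearZ /= symS symT.
rewrite mulmxDr mulmxDl -scalemxAr -scalemxAl addmxE scalemxE.
by rewrite addr_ge0 ?mulr_ge0.
Qed.

Lemma psd_block_form n (a : R) (v : 'cV[R]_n) (B : 'M[R]_n) :
  psd_mat (block_mx a%:M v^T v B : 'M[R]_(1 + n)) ->
  B^T = B /\ forall t y, 0 <= a * t ^+ 2 + 2 * t * dotv v y + (y^T *m B *m y) 0 0.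
Proof.
move=> [sym psd]; split.
  by move: sym; rewrite tr_block_mx => /eq_block_mx [].
move=> t y; have := psd (col_mx t%:M y).
rewrite tr_col_mx -mulmxA mul_block_col mul_row_col tr_scalar_mx.
rewrite -!scalar_mxM mul_scalar_mx mul_mx_scalar mulmxDr.
rewrite -scalemxAr !(addmxE, scalemxE) mulmxA -!dotvE (dotvC y v) mxE eqxx mulr1n.
by congr (_ <= _); ring.
Qed.

(** Induction on the size: the first row and column are split off, and the Schur complement
    [B - a^-1 *: (v *m v^T)] is again semidefinite. Singular matrices are covered, since a zero
    pivot [a] forces [v = 0]. *)
Lemma psd_cholesky n (S : 'M[R]_n) : psd_mat S ->
  exists2 L : 'M[R]_n, is_trig_mx L & S = L *m L^T.
Proof.
elim: n => [|n IH] in S *.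
  by move=> _; exists 0; rewrite ?mx0_is_trig// mul0mx flatmx0.
move=> psdS; have [symS _] := psdS.
pose a : R := S 0 0; pose v := dlsubmx (S : 'M[R]_(1 + n)).
pose B := drsubmx (S : 'M[R]_(1 + n)).
have SE : S = block_mx a%:M v^T v B :> 'M[R]_(1 + n).
  rewrite -[LHS](@submxK R 1 n 1 n); congr block_mx.
    by rewrite [LHS]mx11_scalar !mxE; congr (S _ _)%:M; apply: val_inj.
  by rewrite /v -{2}symS trmx_dlsub trmxK.
move: psdS; rewrite SE => /psd_block_form [symB form].
have a0 : 0 <= a.
  by have := form 1 0; rewrite !mulmx0 !mxE dotvE mulmx0 mxE; lra.
have v0 : a = 0 -> v = 0.
  move=> aE; apply/eqP; rewrite -norm2sq_eq0; apply: contraT => nv.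
  (* With [a = 0] the form is affine in its scalar argument with slope 2|v|^2; this value of the
     argument makes it -1. *)
  have := form (- ((v^T *m B *m v) 0 0 + 1) / (2 * norm2sq v)) v.
  rewrite aE mul0r add0r -/(norm2sq v).
  set Q := (v^T *m B *m v) 0 0.
  rewrite (_ : 2 * _ * _ + Q = -1); first by rewrite ler0N1.
  by field.
have [|L trigL LE] := IH (B - a^-1 *: (v *m v^T)).
  split=> [|y]; first by rewrite linearB linearZ /= trmx_mul trmxK symB.
  (* For [a > 0] this scalar minimizes the form at fixed [y], and the minimum is the form of the
     Schur complement. For [a = 0] the convention 0^-1 = 0 makes the scalar zero. *)
  have := form (- a^-1 * dotv v y) y.
  rewrite -scaleNr mulmxDr mulmxDl -scalemxAr -scalemxAl addmxE scalemxE.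
  have -> : (y^T *m (v *m v^T) *m y) 0 0 = dotv v y ^+ 2.
    rewrite mulmxA -mulmxA mxE big_ord1 -!dotvE (dotvC y v); ring.
  have [aE|an0] := eqVneq a 0; first by rewrite aE invr0; lra.
  by congr (_ <= _); field.
have sqa : Num.sqrt a * Num.sqrt a = a by rewrite -expr2 sqr_sqrtr.
pose L1 : 'M[R]_(1 + n) := block_mx (Num.sqrt a)%:M 0 ((Num.sqrt a)^-1 *: v) L.
have trigL1 : is_trig_mx L1.
  by rewrite is_trig_block_mx // eqxx trigL scalar_mx_is_trig.
exists L1 => //; suff : block_mx a%:M v^T v B = L1 *m L1^T by [].
have sV : Num.sqrt a *: ((Num.sqrt a)^-1 *: v) = v.
  rewrite scalerA; have [aE|an0] := eqVneq a 0; first by rewrite v0 ?scaler0.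
  by rewrite divff ?scale1r// sqrtr_eq0 -ltNge lt_def an0.
rewrite /L1 tr_block_mx mulmx_block !tr_scalar_mx trmx0 !mul0mx !mulmx0 !addr0.
have sVt : Num.sqrt a *: ((Num.sqrt a)^-1 *: v^T) = v^T.
  by have := congr1 trmx sV; rewrite linearZ /= linearZ.
rewrite -scalar_mxM sqa mul_scalar_mx mul_mx_scalar linearZ /= sV sVt.
congr block_mx; rewrite -LE -scalemxAl -scalemxAr scalerA -invfM sqa.
by rewrite addrC subrK.
Qed.

Lemma pd_psd n (S : 'M[R]_n) : pd_mat S -> psd_mat S.
Proof.
move=> [symS pdS]; split=> // v; have [->|/pdS /ltW //] := eqVneq v 0.
by rewrite mulmx0 mxE.
Qed.

Lemma pd_unit n (S : 'M[R]_n) : pd_mat S -> S \in unitmx.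
Proof.
move=> [_ pdS]; rewrite -row_free_unit; apply: inj_row_free => v vS.
apply/eqP; apply: contraT => v0; have := pdS v^T.
by rewrite trmx_eq0 trmxK vS mul0mx mxE ltxx => /(_ v0).
Qed.

(** With S = L L^T the form at v is |L^T v|^2, so where it vanishes S v = 0. *)
Lemma psd_unit_pd n (S : 'M[R]_n) : psd_mat S -> S \in unitmx -> pd_mat S.
Proof.
move=> psdS uS; have [symS _] := psdS; split=> // v v0.
have [L _ SE] := psd_cholesky psdS.
rewrite lt_def psdS.2 andbT; apply: contra v0.
rewrite SE gram_form norm2sq_eq0 => /eqP Lv.
by rewrite -[v](mulKmx uS) SE -mulmxA Lv !mulmx0.
Qed.

(* The Cholesky factor K of M gives Hadamard's bound
   det M = prod K_ii^2 with K_ii^2 <= M_ii. *)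
Lemma ln_det_le_trace n (M : 'M[R]_n) : psd_mat M -> M \in unitmx ->
  ln (\det M) <= \tr M - n%:R.
Proof.
move=> /psd_cholesky [K trigK ->]; rewrite unitmx_mul => /andP[uK _].
have K0 i : 0 < K i i ^+ 2.
  rewrite lt_def sqr_ge0 andbT sqrf_eq0.
  move: uK; rewrite unitmxE unitfE (det_trig trigK).
  by move/prodf_neq0; apply.
rewrite det_mulmx det_tr -expr2 (det_trig trigK) -prodrXl.
apply: (le_trans (ln_prod_le K0)); rewrite sumrB sumr_const card_ord lerD2r.
apply: ler_sum => i _; rewrite mxE (bigD1 i)//= mxE -expr2 lerDl.
by apply: sumr_ge0 => j _; rewrite mxE -expr2 sqr_ge0.
Qed.

Lemma pd_det_gt0 n (S : 'M[R]_n) : pd_mat S -> 0 < \det S.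
Proof.
move=> pdS; have [L _ SE] := psd_cholesky (pd_psd pdS).
have := pd_unit pdS; rewrite unitmxE unitfE lt_def => ->.
by rewrite SE det_mulmx det_tr -expr2 sqr_ge0.
Qed.

(** Concavity of log det. Writing Y = L L^T and X = L M L^T reduces it to the trace bound for M;
    since L^T Q L = 1, tr (Q X) = tr M. *)
Lemma ln_det_le_tangent n (X Y Q : 'M[R]_n) : pd_mat X -> pd_mat Y ->
  Q *m Y = 1%:M -> ln (\det X) <= ln (\det Y) + \tr (Q *m (X - Y)).
Proof.
move=> pdX pdY QY; have [L _ YE] := psd_cholesky (pd_psd pdY).
have uY := pd_unit pdY; have /andP[uL uLt] : (L \in unitmx) && (L^T \in unitmx).
  by rewrite -unitmx_mul -YE.
pose M := invmx L *m X *m (invmx L)^T.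
have uM : M \in unitmx.
  by rewrite !unitmx_mul unitmx_tr unitmx_inv uL (pd_unit pdX).
have XE : X = L *m M *m L^T.
  by rewrite /M !mulmxA mulmxV// mul1mx -mulmxA -trmx_mul mulmxV// trmx1 mulmx1.
have pM : psd_mat M by apply/psd_congr/pd_psd.
have dM : 0 < \det M by apply/pd_det_gt0/psd_unit_pd.
have -> : \det X = \det Y * \det M by rewrite XE YE !det_mulmx; ring.
have dY := pd_det_gt0 pdY.
rewrite lnM ?posrE// lerD2l (le_trans (ln_det_le_trace pM uM))//.
rewrite mulmxBr QY linearB /= mxtrace1 lerD2r le_eqVlt; apply/orP; left; apply/eqP.
rewrite XE !mulmxA [RHS]mxtrace_mulC !mulmxA.
suff -> : L^T *m Q *m L = 1%:M by rewrite mul1mx.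
by rewrite -mulmxA; apply: mulmx1C; rewrite -mulmxA -YE.
Qed.

End PositiveSemidefinite.

(** * The semidefinite cone in vectorized form *)

Section PsdCone.
Context {R : realType} {n : nat}.
Implicit Types (s z p : 'cV[R]_(n * n)) (M : 'M[R]_n).

Definition colvec M : 'cV[R]_(n * n) := (mxvec M)^T.

Lemma colvecK M : mat (colvec M) = M.
Proof. by rewrite /mat trmxK mxvecK. Qed.

Lemma mat_inj : injective (@mat R n).
Proof. by move=> s z /(can_inj vec_mxK) /trmx_inj. Qed.

Lemma matD s z : mat (s + z) = mat s + mat z.
Proof. by rewrite /mat !linearD. Qed.

Lemma matZ a s : mat (a *: s) = a *: mat s.
Proof. by rewrite /mat !linearZ. Qed.

Lemma matB s z : mat (s - z) = mat s - mat z.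
Proof. by rewrite /mat !linearB. Qed.

Lemma dotv_trace s z : dotv s z = \tr ((mat s)^T *m mat z).
Proof.
rewrite /dotv (reindex _ (curry_mxvec_bij _ _)) /=.
pose F i j := s (mxvec_index i j) 0 * z (mxvec_index i j) 0.
rewrite (eq_bigr (fun ij => F ij.1 ij.2)) => [|[]//]; rewrite -(pair_bigA _ F) /=.
rewrite exchange_big; apply: eq_bigr => j _; rewrite mxE.
by apply: eq_bigr => i _; rewrite !mxE.
Qed.

(** Tested on the rank-one matrices v v^T, whose inner product with Z is v^T Z v. *)
Lemma psd_dual_psd z : psd_dual z -> psd_mat (mat z).
Proof.
move=> [symz dz]; split=> // v; have := dz (colvec (v *m v^T)).
rewrite /psd_cone colvecK dotv_trace colvecK trmx_mul trmxK.
rewrite mxtrace_mulC mulmxA mxtrace_mulC mulmxA trace_mx11; apply; exact: gram_psd.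
Qed.

(** The inverse [M] of [mat p] is an argument because a closed form for it is available at the test
    point. *)
Lemma psd_barrier_subgradient p s M : psd_int p -> psd_int s ->
  M^T = M -> M *m mat p = 1%:M ->
  psd_barrier p + dotv (colvec (- M)) (s - p) <= psd_barrier s.
Proof.
move=> pp ps symM Mp; rewrite /psd_barrier dotv_trace colvecK matB.
rewrite linearN /= symM mulNmx linearN /=.
by have := ln_det_le_tangent ps pp Mp; lra.
Qed.

(** With S = L L^T and Z = N N^T, the trace is the squared Frobenius norm of L^T N. *)
Lemma psd_complementary (S Z : 'M[R]_n) : psd_mat S -> psd_mat Z ->
  \tr (S *m Z) = 0 -> S *m Z = 0.
Proof.
move=> /psd_cholesky[L _ ->] /psd_cholesky[N _ ->] tr0.
suff /eqP LN : L^T *m N == 0.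
  by rewrite mulmxA -(mulmxA L) LN mulmx0 mul0mx.
move: tr0; rewrite mulmxA mxtrace_mulC !mulmxA.
have -> : N^T *m L *m L^T *m N = (L^T *m N)^T *m (L^T *m N).
  by rewrite trmx_mul trmxK !mulmxA.
move=> tr0; apply/eqP/matrixP => i j; rewrite [RHS]mxE.
have /matrixP/(_ i 0) : col j (L^T *m N) = 0; last by rewrite !mxE.
apply/eqP; rewrite -norm2sq_eq0 -gram_diag; apply/eqP.
by apply: (psumr_eq0P _ tr0) => // l _; rewrite gram_diag norm2sq_ge0.
Qed.

Lemma sym_mulmx_eq0 (u : 'rV[R]_n) (S : 'M[R]_n) :
  S^T = S -> u *m S *m S = 0 -> u *m S = 0.
Proof.
move=> symS uSS; apply/eqP; rewrite -trmx_eq0 -norm2sq_eq0 /norm2sq dotvE trmxK.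
by rewrite trmx_mul symS mulmxA uSS mul0mx mxE.
Qed.

Lemma strict_complementary_unit (S Z : 'M[R]_n) : S^T = S -> Z^T = Z ->
  S *m Z = 0 -> (\rank S + \rank Z = n)%N -> S + Z \in unitmx.
Proof.
move=> symS symZ SZ rk; have ZS : Z *m S = 0.
  by rewrite -[Z *m S]trmxK trmx_mul symS symZ SZ trmx0.
rewrite -row_free_unit; apply: inj_row_free => u uW.
have uS : u *m S = 0.
  apply: sym_mulmx_eq0 => //.
  have := congr1 (mulmx^~ S) uW.
  by rewrite mul0mx mulmxDr mulmxDl -(mulmxA u Z) ZS mulmx0 addr0.
have uZ : u *m Z = 0 by move: uW; rewrite mulmxDr uS add0r.
(* Z S = 0 puts the row space of Z inside the left kernel of S, and the rank condition makes them
   equal. Hence u = w Z, and u Z = w Z Z = 0 gives u = 0. *)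
have /geq_leqif : (\rank Z <= \rank (kermx S) ?= iff (Z == kermx S)%MS)%N.
  by apply: mxrank_leqif_eq; apply/sub_kermxP.
rewrite mxrank_ker -{1}rk addKn leqnn => /esym/eqmxP eqZ.
have /submxP[w uE] : (u <= Z)%MS by rewrite eqZ; apply/sub_kermxP.
by move: uZ; rewrite uE; exact: sym_mulmx_eq0.
Qed.

(* As S and Z commute with W = S + Z and S Z = 0, the matrices W^-1 S W^-1 and
   W^-1 Z W^-1 are the pseudo-inverses of S and Z. *)
Lemma strict_complementary_inv (S Z : 'M[R]_n) (mu : R) :
  let V := invmx (S + Z) in
  S^T = S -> Z^T = Z -> S *m Z = 0 -> S + Z \in unitmx -> mu != 0 ->
  (V *m S *m V + mu^-1 *: Z) *m (S + mu *: (V *m Z *m V)) = 1%:M.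
Proof.
move=> V symS symZ SZ uW mu0; have ZS : Z *m S = 0.
  by rewrite -[Z *m S]trmxK trmx_mul symS symZ SZ trmx0.
have VC M : (S + Z) *m M = M *m (S + Z) -> V *m M = M *m V.
  move=> WM; rewrite -[M in LHS](mulmxK uW) -WM.
  by rewrite !mulmxA mulVmx// mul1mx.
have VS : V *m S = S *m V by apply: VC; rewrite mulmxDl mulmxDr ZS SZ.
have VZ : V *m Z = Z *m V by apply: VC; rewrite mulmxDl mulmxDr ZS SZ.
have VSr (X : 'M[R]_n) : V *m (S *m X) = S *m (V *m X) by rewrite mulmxA VS -mulmxA.
have VZr (X : 'M[R]_n) : V *m (Z *m X) = Z *m (V *m X) by rewrite mulmxA VZ -mulmxA.
rewrite mulmxDl !mulmxDr -!scalemxAl -!scalemxAr scalerA mulVf// scale1r ZS scaler0 add0r.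
have -> : V *m S *m V *m (V *m Z *m V) = 0.
  by rewrite -!mulmxA !VZr (mulmxA S) SZ mul0mx mulmx0.
rewrite scaler0 addr0.
have -> : V *m S *m V *m S = V *m V *m (S *m S) by rewrite -!mulmxA !(VSr, VS).
have -> : Z *m (V *m Z *m V) = V *m V *m (Z *m Z) by rewrite -!mulmxA !(VZr, VZ).
(* The cross terms are gone; with W = S + Z what remains is V V (S S + Z Z) = V V W (S + Z) = V V W
   W = 1. *)
have -> : S *m S = (S + Z) *m S by rewrite mulmxDl ZS addr0.
have -> : Z *m Z = (S + Z) *m Z by rewrite mulmxDl SZ add0r.
by rewrite -mulmxDr -mulmxDr -mulmxA mulKmx// mulVmx.
Qed.

Lemma psd_argmin_dist (ss zs : 'cV[R]_(n * n)) :
  psd_cone ss -> psd_dual zs -> dotv ss zs = 0 ->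
  (\rank (mat ss) + \rank (mat zs) = n)%N ->
  exists2 K : R, 0 <= K & forall mu s0, 0 < mu ->
    is_argmin psd_int (bar_obj psd_barrier mu (ss - 1 *: zs)) s0 ->
    forall i, `|(s0 - ss) i 0| <= K * mu.
Proof.
move=> psdS /psd_dual_psd psdZ sz rk.
have [symS _] := psdS; have [symZ _] := psdZ.
move: sz; rewrite dotv_trace symS => /(psd_complementary psdS psdZ) SZ.
have uW := strict_complementary_unit symS symZ SZ rk.
set V := invmx (mat ss + mat zs).
have symV : V^T = V by rewrite trmx_inv linearD /= symS symZ.
have psdV M : psd_mat M -> psd_mat (V *m M *m V).
  by rewrite -{2}symV; exact: psd_congr.
pose Sp := V *m mat ss *m V; pose Zp := V *m mat zs *m V.
pose w := colvec Zp; pose h := colvec (Zp - Sp).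
exists (2 * Num.sqrt (norm2sq h) + norm_inf w).
  by rewrite addr_ge0 ?mulr_ge0 ?sqrtr_ge0 ?norm_inf_ge0.
move=> mu s0 mu0 min0 i.
have pE : mat (ss + mu *: w) = mat ss + mu *: Zp by rewrite matD matZ colvecK.
have inv := strict_complementary_inv symS symZ SZ uW (lt0r_neq0 mu0).
rewrite -/V -/Sp -/Zp -pE in inv.
have pp : psd_int (ss + mu *: w).
  (* The explicit inverse upgrades semidefinite to definite. *)
  apply: psd_unit_pd; last by have [] := mulmx1_unit inv.
  by rewrite pE; apply: psd_addZ; [exact: ltW| |exact: psdV].
have symM : (Sp + mu^-1 *: mat zs)^T = Sp + mu^-1 *: mat zs.
  by rewrite linearD linearZ /= symZ (psdV _ psdS).1.
apply: (argmin_coord_dist (G := colvec (- (Sp + mu^-1 *: mat zs))) _ mu0 min0 pp).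
  by move=> s ps; exact: psd_barrier_subgradient.
(* In matrix form p - c = mu Zp + Z and mu G = -mu Sp - Z, so Z cancels and mu (Zp - Sp) remains. *)
apply: mat_inj; rewrite matD matB pE !matZ matB !colvecK matZ scale1r.
rewrite scalerN scalerDr scalerA divff ?gt_eqF// scale1r scalerBr.
move: (mu *: Zp) (mu *: Sp) (mat ss) (mat zs) => A B C D.
by apply/matrixP => j l; rewrite !mxE; ring.
Qed.

End PsdCone.

(** * The second-order cone *)

Section SecondOrderCone.
Context {R : realType} {n : nat}.
Implicit Types (s z p : 'cV[R]_n.+1) (x : 'cV[R]_n).

Definition soc_vec (t : R) x : 'cV[R]_n.+1 :=
  \col_i (if unlift ord0 i is Some j then x j 0 else t).

Lemma soc_t_vec t x : soc_t (soc_vec t x) = t.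
Proof. by rewrite /soc_t mxE unlift_none. Qed.

Lemma soc_x_vec t x : soc_x (soc_vec t x) = x.
Proof. by apply/matrixP => i j; rewrite !mxE liftK ord1. Qed.

Lemma soc_eq s z : soc_t s = soc_t z -> soc_x s = soc_x z -> s = z.
Proof.
move=> et ex; apply/matrixP => i j; rewrite ord1.
by case: (unliftP ord0 i) => [l ->|->//]; have /matrixP/(_ l 0) := ex; rewrite !mxE.
Qed.

Lemma soc_tD s z : soc_t (s + z) = soc_t s + soc_t z.
Proof. by rewrite /soc_t mxE. Qed.

Lemma soc_tZ (a : R) s : soc_t (a *: s) = a * soc_t s.
Proof. by rewrite /soc_t mxE. Qed.

Lemma soc_tN s : soc_t (- s) = - soc_t s.
Proof. by rewrite /soc_t mxE. Qed.

Lemma soc_xD s z : soc_x (s + z) = soc_x s + soc_x z.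
Proof. by apply/matrixP => i j; rewrite !mxE. Qed.

Lemma soc_xZ (a : R) s : soc_x (a *: s) = a *: soc_x s.
Proof. by apply/matrixP => i j; rewrite !mxE. Qed.

Lemma soc_xN s : soc_x (- s) = - soc_x s.
Proof. by apply/matrixP => i j; rewrite !mxE. Qed.

Definition soc_linE := (soc_tD, soc_tZ, soc_tN, soc_xD, soc_xZ, soc_xN).

Lemma soc_dotv s z : dotv s z = soc_t s * soc_t z + dotv (soc_x s) (soc_x z).
Proof.
by rewrite /dotv big_ord_recl; congr (_ + _); apply: eq_bigr => i _; rewrite !mxE.
Qed.

(** The Lorentz form, which is the determinant of the Jordan algebra attached to the cone. *)
Definition soc_det s : R := soc_t s ^+ 2 - norm2sq (soc_x s).

Lemma soc_intP s : soc_int s <-> 0 < soc_t s /\ 0 < soc_det s.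
Proof.
rewrite /soc_int /soc_det; have a0 := sqrtr_ge0 (norm2sq (soc_x s)).
have := sqr_sqrtr (norm2sq_ge0 (soc_x s)).
move: a0; set a := Num.sqrt _ => a0 aE; split=> [lt|[t0]].
  have t0 : 0 < soc_t s by exact: le_lt_trans lt.
  by split => //; rewrite subr_gt0 -aE ltrXn2r// ltW.
by rewrite subr_gt0 -aE ltr_pXn2r ?nnegrE// ltW.
Qed.

Lemma soc_reverse_Cauchy_Schwarz s p : soc_int s -> soc_int p ->
  Num.sqrt (soc_det s * soc_det p)
    <= soc_t p * soc_t s - dotv (soc_x p) (soc_x s).
Proof.
rewrite /soc_int /soc_det => si pi.
have := norm_dotv_le (soc_x p) (soc_x s); rewrite ler_norml => /andP[_].
have := sqr_sqrtr (norm2sq_ge0 (soc_x s)); have := sqr_sqrtr (norm2sq_ge0 (soc_x p)).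
have := sqrtr_ge0 (norm2sq (soc_x s)); have := sqrtr_ge0 (norm2sq (soc_x p)).
move: si pi; set a := Num.sqrt (norm2sq (soc_x s)); set b := Num.sqrt (norm2sq _).
move: (soc_t s) (soc_t p) (dotv _ _) => S T d aS bT b0 a0 <- <- dle.
have le0 : b * a <= T * S by nra.
apply: (@le_trans _ _ (T * S - b * a)); last by lra.
rewrite -[leRHS]ger0_norm ?subr_ge0// -sqrtr_sqr ler_wsqrtr//.
(* This square equals (T S - b a)^2 - (S^2 - a^2)(T^2 - b^2). *)
have : 0 <= (S * b - T * a) ^+ 2 by exact: sqr_ge0.
by nra.
Qed.

(** The linear term equals 1 - N / D, where N is the Lorentz product of p and s, D = det p and E =
    det s. The barrier being -ln of the root of the determinant, ln t <= t - 1 is applied at t =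
    sqrt E / sqrt D, and reverse Cauchy-Schwarz gives t <= N / D. *)
Lemma soc_barrier_subgradient p s : soc_int p -> soc_int s ->
  soc_barrier p + dotv (soc_vec (- (soc_t p / soc_det p))
    ((soc_det p)^-1 *: soc_x p)) (s - p) <= soc_barrier s.
Proof.
move=> pi si; have := soc_reverse_Cauchy_Schwarz si pi.
have [_ D0] := (soc_intP p).1 pi; have [_ E0] := (soc_intP s).1 si.
rewrite soc_dotv soc_t_vec soc_x_vec !soc_linE dotvZl dotvDr.
rewrite -[- soc_x p]scaleN1r dotvZr -/(norm2sq _) /soc_barrier -!/(soc_det _).
have -> : norm2sq (soc_x p) = soc_t p ^+ 2 - soc_det p by rewrite /soc_det; ring.
move: (soc_det p) (soc_det s) D0 E0 => D E D0 E0.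
set N := _ - dotv _ _ => leN.
have -> : - (soc_t p / D) * (soc_t s - soc_t p)
    + D^-1 * (dotv (soc_x p) (soc_x s) + -1 * (soc_t p ^+ 2 - D)) = 1 - N / D.
  by rewrite /N; field; rewrite gt_eqF.
have [sD sE] : 0 < Num.sqrt D /\ 0 < Num.sqrt E by rewrite !sqrtr_gt0.
have lnsq (y : R) : 0 < y -> ln y = 2 * ln (Num.sqrt y).
  move=> y0; rewrite -{1}(sqr_sqrtr (ltW y0)) expr2 lnM ?posrE ?sqrtr_gt0//.
  by ring.
have : ln (Num.sqrt E) - ln (Num.sqrt D) <= N / D - 1.
  rewrite -ln_div ?posrE// (le_trans (ln_le_sub1 _)) ?divr_gt0// lerD2r.
  rewrite ler_pdivlMr// -{2}(sqr_sqrtr (ltW D0)) expr2 mulrA divfK ?gt_eqF//.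
  by rewrite -sqrtrM// ltW.
by rewrite (lnsq D)// (lnsq E)//; lra.
Qed.

(** Tested on the boundary vector (|z_x|, -z_x). *)
Lemma soc_dual_self z : 0 < soc_t z -> dual_cone soc_cone z -> soc_cone z.
Proof.
move=> t0 zK; rewrite /soc_cone; have a0 := sqrtr_ge0 (norm2sq (soc_x z)).
have aE := sqr_sqrtr (norm2sq_ge0 (soc_x z)).
have := zK (soc_vec (Num.sqrt (norm2sq (soc_x z))) (- soc_x z)).
rewrite soc_dotv /soc_cone soc_t_vec soc_x_vec -scaleN1r dotvZl norm2sqZ sqrrN expr1n mul1r.
rewrite -/(norm2sq _) lexx => /(_ isT) h; rewrite leNgt; apply/negP => lt.
by nra.
Qed.

(** Orthogonality forces equality in s_t z_t >= |s_x| |z_x| >= -<s_x, z_x>. Both vectors then lie on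
    the boundary with opposite spatial directions. *)
Lemma soc_complementary s z : soc_cone s -> soc_cone z -> dotv s z = 0 ->
  0 < soc_t s -> 0 < soc_t z ->
  norm2sq (soc_x s) = soc_t s ^+ 2 /\
  (soc_t s / soc_t z) *: soc_x z = - soc_x s.
Proof.
rewrite soc_dotv /soc_cone => sK zK sz s0 z0.
have := norm_dotv_le (soc_x s) (soc_x z); rewrite ler_norml => /andP[dle _].
have aE := sqr_sqrtr (norm2sq_ge0 (soc_x s)); have bE := sqr_sqrtr (norm2sq_ge0 (soc_x z)).
have a0 := sqrtr_ge0 (norm2sq (soc_x s)); have b0 := sqrtr_ge0 (norm2sq (soc_x z)).
have ea : Num.sqrt (norm2sq (soc_x s)) = soc_t s by apply: le_anti; rewrite sK /=; nra.
have eb : Num.sqrt (norm2sq (soc_x z)) = soc_t z by apply: le_anti; rewrite zK /=; nra.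
rewrite ea in aE; rewrite eb in bE; split=> //.
apply/eqP; rewrite -subr_eq0 opprK -norm2sq_eq0 norm2sqD norm2sqZ dotvZl dotvC -aE -bE.
have -> : dotv (soc_x s) (soc_x z) = - (soc_t s * soc_t z) by lra.
by apply/eqP; field; rewrite gt_eqF.
Qed.

Lemma soc_argmin_dist (ss zs : 'cV[R]_n.+1) :
  soc_cone ss -> dual_cone soc_cone zs -> dotv ss zs = 0 ->
  0 < soc_t ss -> 0 < soc_t zs ->
  exists2 K : R, 0 <= K & forall mu s0, 0 < mu ->
    is_argmin soc_int
      (bar_obj soc_barrier mu (ss - (soc_t ss / soc_t zs) *: zs)) s0 ->
    forall i, `|(s0 - ss) i 0| <= K * mu.
Proof.
move=> sK zD sz t0 z0.
have [nx lamz] := soc_complementary sK (soc_dual_self z0 zD) sz t0 z0.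
set a := soc_t ss in t0 nx *.
(* tau = 1 / (4 a) makes soc_det (ss + mu w) equal to mu. *)
pose tau := (4 * a)^-1.
pose w := soc_vec tau (- (tau / a) *: soc_x ss).
(* The choice of lambda gives c = (0, 2 s_x), with s_x the spatial part of ss. Since det p = mu, mu
   G = (-p_t, p_x), so the first coordinate of the gradient is 0 and the rest is 2 p_x - 2 s_x = mu
   h_x. *)
pose h := soc_vec 0 (- (2 * tau / a) *: soc_x ss).
exists (2 * Num.sqrt (norm2sq h) + norm_inf w).
  by rewrite addr_ge0 ?mulr_ge0 ?sqrtr_ge0 ?norm_inf_ge0.
move=> mu s0 mu0 min0 i.
pose p := ss + mu *: w.
have pt : soc_t p = a + mu * tau by rewrite !soc_linE soc_t_vec.
have px : soc_x p = (1 - mu * tau / a) *: soc_x ss.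
  by rewrite !soc_linE soc_x_vec scalerA mulrN mulrA scaleNr scalerBl scale1r.
have an0 : a != 0 by rewrite gt_eqF.
have pdet : soc_det p = mu.
  by rewrite /soc_det pt px norm2sqZ nx /tau; field.
have tau0 : 0 < tau by rewrite invr_gt0 mulr_gt0.
have pi : soc_int p.
  by apply/soc_intP; rewrite pdet pt addr_gt0// mulr_gt0.
apply: (argmin_coord_dist _ mu0 min0 pi).
  by move=> s si; exact: soc_barrier_subgradient pi si.
rewrite pdet -/p; apply: soc_eq; rewrite !soc_linE ?soc_t_vec ?soc_x_vec ?pt ?px.
  by rewrite -/a; field; rewrite !gt_eqF.
rewrite lamz opprK; apply/matrixP => j l; rewrite !mxE -/a.
by field; rewrite !gt_eqF.
Qed.

End SecondOrderCone.

Theorem theorem2 (R : realType) :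
  (* (i) nonnegative cone *)
  (forall (nx k : nat) (P : 'M[R]_nx) (q : 'cV[R]_nx) (A : 'M[R]_(k, nx))
     (b : 'cV[R]_k) (ss zs : 'cV[R]_k),
   psd_mat P ->
   nonneg_cone ss -> dual_cone nonneg_cone zs -> dotv ss zs = 0 ->
   (forall i, ss i 0 != 0 \/ zs i 0 != 0) ->
   exists C : R, forall (P' : 'M[R]_nx) (q' : 'cV[R]_nx) (A' : 'M[R]_(k, nx))
     (b' : 'cV[R]_k) (xs : 'cV[R]_nx),
   psd_mat P' -> P' *m xs + A'^T *m zs + q' = 0 -> A' *m xs + ss = b' ->
   let lam : R := 1 in
   let mu0 := norm_inf (residual P q A b xs ss zs) in
   0 < mu0 ->
   let c := ss - lam *: zs in
   forall s0, is_argmin nonneg_int (bar_obj nonneg_barrier mu0 c) s0 ->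
   let z0 := lam^-1 *: (s0 - c) in
   let x0 := xs in
   norm_inf (residual P q A b x0 s0 z0) <= C * mu0)
  /\
  (* (ii) PSD cone *)
  (forall (nx n : nat) (P : 'M[R]_nx) (q : 'cV[R]_nx) (A : 'M[R]_(n * n, nx))
     (b : 'cV[R]_(n * n)) (ss zs : 'cV[R]_(n * n)),
   psd_mat P ->
   psd_cone ss -> psd_dual zs -> dotv ss zs = 0 ->
   (\rank (mat ss) + \rank (mat zs) = n)%N ->
   exists C : R, forall (P' : 'M[R]_nx) (q' : 'cV[R]_nx)
     (A' : 'M[R]_(n * n, nx)) (b' : 'cV[R]_(n * n)) (xs : 'cV[R]_nx),
   psd_mat P' -> P' *m xs + A'^T *m zs + q' = 0 -> A' *m xs + ss = b' ->
   let lam : R := 1 in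
   let mu0 := norm_inf (residual P q A b xs ss zs) in
   0 < mu0 ->
   let c := ss - lam *: zs in
   forall s0, is_argmin psd_int (bar_obj psd_barrier mu0 c) s0 ->
   let z0 := lam^-1 *: (s0 - c) in
   let x0 := xs in
   norm_inf (residual P q A b x0 s0 z0) <= C * mu0)
  /\
  (* (iii) second-order cone in R x R^n *)
  (forall (nx n : nat) (P : 'M[R]_nx) (q : 'cV[R]_nx) (A : 'M[R]_(n.+1, nx))
     (b : 'cV[R]_n.+1) (ss zs : 'cV[R]_n.+1),
   psd_mat P ->
   soc_cone ss -> dual_cone soc_cone zs -> dotv ss zs = 0 ->
   0 < soc_t ss -> 0 < soc_t zs ->
   exists C : R, forall (P' : 'M[R]_nx) (q' : 'cV[R]_nx)
     (A' : 'M[R]_(n.+1, nx)) (b' : 'cV[R]_n.+1) (xs : 'cV[R]_nx),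
   psd_mat P' -> P' *m xs + A'^T *m zs + q' = 0 -> A' *m xs + ss = b' ->
   let lam : R := soc_t ss / soc_t zs in
   let mu0 := lam * norm_inf (residual P q A b xs ss zs) in
   0 < mu0 ->
   let c := ss - lam *: zs in
   forall s0, is_argmin soc_int (bar_obj soc_barrier mu0 c) s0 ->
   let z0 := lam^-1 *: (s0 - c) in
   let x0 := xs in
   norm_inf (residual P q A b x0 s0 z0) <= C * mu0).
Proof.
split; [|split].
- move=> nx k P q A b ss zs _ sK zK sz str.
  have [K K0 dist] := nonneg_argmin_dist sK zK sz str.
  (* [K] depends only on [ss] and [zs], so the constant is fixed before [xs] and [mu0] are
     introduced. *)
  exists (1^-1 + (1^-1 * abs_sum A + 1) * K).
  move=> P' q' A' b' xs _ _ _ lam mu0 mu0_gt0 c s0 min0; cbv zeta.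
  apply: le_trans (residual_perturb_le ltr01 K0 _) _; last by rewrite mul1r.
  by rewrite mul1r; exact: dist.
- move=> nx n P q A b ss zs _ sK zK sz str.
  have [K K0 dist] := psd_argmin_dist sK zK sz str.
  exists (1^-1 + (1^-1 * abs_sum A + 1) * K).
  move=> P' q' A' b' xs _ _ _ lam mu0 mu0_gt0 c s0 min0; cbv zeta.
  apply: le_trans (residual_perturb_le ltr01 K0 _) _; last by rewrite mul1r.
  by rewrite mul1r; exact: dist.
- move=> nx n P q A b ss zs _ sK zK sz t0 u0.
  have [K K0 dist] := soc_argmin_dist sK zK sz t0 u0.
  set l := soc_t ss / soc_t zs.
  exists (l^-1 + (l^-1 * abs_sum A + 1) * K).
  move=> P' q' A' b' xs _ _ _ lam mu0 mu0_gt0 c s0 min0; cbv zeta.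
  by apply: residual_perturb_le => //; [exact: divr_gt0 | exact: dist].
Qed.
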